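(* Let $(X,d)$ be a compact metric space and let ${\bf m}$ be a Borel probability measure on $X$ such that the metric measure space $(X,d,{\bf m})$ is regular. For every $\mu\in P(X)$, $$\operatorname{var}(B(\mu))\le\operatorname{var}(\mu).$$ Moreover, equality $\operatorname{var}(B(\mu))=\operatorname{var}(\mu)$ holds if and only if $\operatorname{supp}\mu\subset\operatorname{supp}B(B(\mu))$.
   Context: $P(X)$ is the set of Borel probability measures on $X$ with the weak-* topology. For $\mu,\nu\in P(X)$, $W_2^2(\mu,\nu)=\inf_\gamma\int_{X\times X}d^2(x,y)\,d\gamma(x,y)$, where the infimum is over all Borel probability measures $\gamma$ on $X\times X$ with first marginal $\mu$ and second marginal $\nu$; $W_2\ge 0$ is its square root. The variance of $\mu\in P(X)$ is $\operatorname{var}(\mu)=\min_{y\in X}\int_X d^2(x,y)\,d\mu(x)$. For $\mu\in P(X)$, $b(\mu)=\operatorname{argmin}_{y\in X}\int_X d^2(x,y)\,d\mu(x)$ is the set of barycentric points of $\mu$. $(X,d,{\bf m})$ is called regular if for every $\nu\in P(X)$, any minimizer $\gamma$ in the definition of $W_2({\bf m},\nu)$ is concentrated on the graph of a function, that is, $\gamma=(\mathrm{Id},T)_\#{\bf m}$ for a map $T:X\to X$. When $(X,d,{\bf m})$ is regular, for $\mu\in P(X)$ and $\epsilon>0$ the functional $F_\epsilon(\nu)=\int_X\int_X d^2(y,x)\,d\mu(x)\,d\nu(y)+\epsilon W_2^2({\bf m},\nu)$ has a unique minimizer $\mu_\epsilon\in P(X)$, and the Wasserstein regularized barycenter $B(\mu)\in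 P(X)$ of $\mu$ is the weak-* limit of $\mu_\epsilon$ as $\epsilon\to0$ (which exists); equivalently, $B(\mu)$ is the unique minimizer of $\nu\mapsto W_2(\nu,{\bf m})$ among $\nu\in P(X)$ with $\operatorname{supp}\nu\subset b(\mu)$.
   Formalization: The direction ''var(B(μ)) = var(μ) implies supp μ ⊂ supp B(B(μ))'' is proved under the added assumption supp m = X, without which it is false; the inequality and the converse direction hold for every regular m. *)

(* Defs.v *)
From HB Require Import structures.
From mathcomp Require Import all_boot all_order all_algebra.
From mathcomp Require Import all_classical all_reals all_analysis.

Set Implicit Arguments.
Unset Strict Implicit.
Unset Printing Implicit Defensive.

Import Order.TTheory GRing.Theory Num.Theory.
Import numFieldNormedType.Exports.

Local Open Scope classical_set_scope.
Local Open Scope ring_scope.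

(* Measurable types are pointed in this library, hence so is the metric space;
   a space carrying a probability measure is nonempty anyway. *)
#[short(type="pmetricType")]
HB.structure Definition PMetric (K : numDomainType) :=
  { M of Metric K M & Pointed M }.

Notation borelType X := (g_sigma_algebraType (@open X)).

Section WassersteinBarycenter.
Context {R : realType} {X : pmetricType R}.
Implicit Types (m mu nu : probability (borelType X) R).
Local Open Scope ereal_scope.

Definition sqdist (x y : X) : \bar R := ((mdist x y : R) ^+ 2)%:E.

Definition supp mu : set X :=
  [set x | forall U : set X, open U -> U x -> 0 < mu U].

Definition var_at mu (y : X) : \bar R := \int[mu]_x sqdist x y.

(* The infimum is attained when X is compact. *)
Definition var mu : \bar R := ereal_inf (range (var_at mu)).

(* Plans live on the product sigma-algebra, which is the Borel sigma-algebra
   of X * X when X is compact metric (hence second countable). *)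
Definition plan : Type :=
  probability (borelType X * borelType X)%type R.

Definition coupling mu nu : set plan :=
  [set gamma | (forall A : set (borelType X), measurable A ->
                  pushforward gamma fst A = mu A) /\
               (forall A : set (borelType X), measurable A ->
                  pushforward gamma snd A = nu A)].

Definition cost (gamma : plan) : \bar R := \int[gamma]_z sqdist z.1 z.2.

(* W_2 squared *)
Definition W2sq mu nu : \bar R := ereal_inf (cost @` coupling mu nu).

Definition optimal_plan mu nu (gamma : plan) : Prop :=
  coupling mu nu gamma /\ cost gamma = W2sq mu nu.

(* Regularity does not force supp m = [set: X]; where full support matters it
   has to be assumed separately. *)
Definition regular m : Prop :=
  forall nu (gamma : plan), optimal_plan m nu gamma ->
    exists T : borelType X -> borelType X,
      measurable_fun [set: borelType X] T /\
      forall A : set (borelType X * borelType X), measurable A ->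
        gamma A = pushforward m (fun x => (x, T x)) A.

Definition reg_functional m mu (e : R) nu : \bar R :=
  \int[nu]_y \int[mu]_x sqdist y x + e%:E * W2sq m nu.

Definition reg_minimizer m mu (e : R) nu : Prop :=
  forall nu', reg_functional m mu e nu <= reg_functional m mu e nu'.

Definition weak_cvg0 (mu_ : R -> probability (borelType X) R) nu : Prop :=
  forall f : X -> R, continuous f ->
    (\int[mu_ e]_x f x)%R @[e --> 0^'+] --> (\int[nu]_x f x)%R.

(* nu = B(mu). When m is regular the minimizers are unique and the limit
   exists and is unique, so this relation is the graph of B. *)
Definition is_regularized_barycenter m mu nu : Prop :=
  exists mu_ : R -> probability (borelType X) R,
    (forall e : R, (0 < e)%R -> reg_minimizer m mu e (mu_ e)) /\
    weak_cvg0 mu_ nu.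

End WassersteinBarycenter.

(* Main.v *)
(* Write V_mu(y) = int d(x,y)^2 dmu(x), and b(mu) for its set of minimizers.
   Comparing mu_e with a Dirac mass at a point of b(mu) and letting e tend to 0
   shows that B(mu) is supported in b(mu).  By Fubini,
     int V_{B(mu)} dmu = int V_mu dB(mu) = var(mu),
   so var(B(mu)) = min V_{B(mu)} <= var(mu), with equality if and only if
   supp mu is contained in b(B(mu)).  It remains to see that
   supp B(nu) = b(nu) when m has full support.  Almost-nearest-point maps to
   K = b(nu) give W_2^2(m, nu_e) <= int d(x,K)^2 dm(x) for every e > 0, while a
   dual pair of potentials shows that any plan charging little mass near a point
   z of K is more expensive than this by a fixed amount: the m-mass close to z,
   which is positive, has to travel further than to K. *)
Require Import Defs.
From mathcomp Require Import all_boot all_order all_algebra.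
From mathcomp Require Import all_classical all_reals all_analysis.
From mathcomp Require Import measurable_realfun lra.

Set Implicit Arguments.
Unset Strict Implicit.
Unset Printing Implicit Defensive.

Import Order.TTheory GRing.Theory Num.Theory.
Import numFieldNormedType.Exports.

Local Open Scope classical_set_scope.
Local Open Scope ring_scope.
Local Open Scope ereal_scope.

Lemma countable_bigcup_seq (I T : Type) (D : set I) (F : I -> set T) :
  countable D -> exists G : nat -> set T,
    \bigcup_(i in D) F i = \bigcup_n G n /\
    forall n, G n = set0 \/ exists2 i, D i & G n = F i.
Proof.
move=> /countable_injP[f finj].
exists (fun n => \bigcup_(i in [set i | D i /\ f i = n]) F i); split.
  apply/seteqP; split => [t [i Di Fit]|t [n _ [i [Di _] Fit]]]; last by exists i.
  by exists (f i) => //; exists i.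
move=> n; have [[i [Di fin]]|noi] := pselect (exists i, D i /\ f i = n).
  right; exists i => //; apply/seteqP; split => [t [j [Dj fjn] Fjt]|t Fit].
    by rewrite (_ : i = j)//; apply: finj; rewrite ?inE// fjn.
  by exists i.
by left; apply/seteqP; split => // t [i Dfi _]; apply: noi; exists i.
Qed.

(** * Continuity and Borel measurability on a compact metric space *)

Section CompactMetric.
Context {R : realType} {X : pmetricType R}.
Local Open Scope ring_scope.
Implicit Types (x y z : X) (f : X -> R).

Lemma lipschitz_continuous f (C : R) :
  (forall x y, `|f x - f y| <= C * mdist x y) -> continuous f.
Proof.
move=> fC x; apply/cvgrPdist_lt => e e0.
(* Adding 1 makes the divisor positive whatever [C] is. *)
have D0 : 0 < `|C| + 1 by rewrite ltr_wpDl.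
have : nbhs x (ball x (e / (`|C| + 1))) by apply: nbhsx_ballx; rewrite divr_gt0.
apply: filterS => y; rewrite ballEmdist /= ltr_pdivlMr// mulrC => xy.
apply: le_lt_trans (fC x y) (le_lt_trans _ xy).
rewrite ler_wpM2r ?mdist_ge0//.
by rewrite (le_trans (ler_norm C))// lerDl.
Qed.

Lemma mdist_lipschitz z x y : `|mdist z x - mdist z y| <= mdist x y :> R.
Proof.
have := metric_triangle z x y; have := metric_triangle z y x.
rewrite (metric_sym y x) => *; rewrite ler_norml; lra.
Qed.

Lemma mdist_continuous z : continuous (mdist z : X -> R).
Proof.
by apply: (@lipschitz_continuous _ 1) => x y; rewrite mul1r mdist_lipschitz.
Qed.

Lemma measurable_open_borel (U : set X) : open U ->
  measurable (U : set (borelType X)).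
Proof. by move=> oU; exact: sub_sigma_algebra. Qed.

Lemma continuous_measurable_borel f : continuous f ->
  measurable_fun [set: borelType X] (f : borelType X -> R).
Proof.
move=> /continuousP cf; apply: (measurability _ (RGenOpens.measurableE R)).
move=> _ [_ [a [b ->] <-]]; rewrite setTI.
have oA : open (f @^-1` `]a, b[%classic) by apply: cf; exact: interval_open.
exact: measurable_open_borel oA.
Qed.

Hypothesis cptX : compact [set: X].

Lemma continuous_argmin f : continuous f -> exists y, forall x, f y <= f x.
Proof.
move=> cf.
have [||y _ ymin] := @compact_EVT_min X R f setT _ cptX.
- by exists point.
- exact: continuous_subspaceT.
by exists y => x; apply: ymin; rewrite inE.
Qed.

Lemma continuous_ubound f : continuous f -> exists M, forall x, f x <= M.
Proof.
move=> cf.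
have [||y _ ymax] := @compact_EVT_max X R f setT _ cptX.
- by exists point.
- exact: continuous_subspaceT.
by exists (f y) => x; apply: ymax; rewrite inE.
Qed.

Lemma mdist_bounded : exists2 D : R, 0 < D & forall x y, mdist x y <= D.
Proof.
have [M hM] := continuous_ubound (@mdist_continuous point).
have M0 : 0 <= M := le_trans (mdist_ge0 _ _) (hM point).
exists (M + M + 1); first by lra.
move=> x y; have := metric_triangle x point y.
rewrite (metric_sym x point); have := hM x; have := hM y; lra.
Qed.

Lemma continuous_integrable (mu : probability (borelType X) R) f :
  continuous f -> mu.-integrable [set: borelType X] (EFin \o f).
Proof.
move=> cf; apply: measurable_bounded_integrable => //.
- by apply: le_lt_trans (probability_le1 mu _) (ltry _).
- exact: continuous_measurable_borel.
have cnf : continuous (fun x => `|f x|).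
  by move=> x; apply: continuous_comp; [exact: cf|exact: norm_continuous].
have [M hM] := continuous_ubound cnf.
exists M; split; first exact: num_real.
by move=> N MN x _ /=; apply: le_trans (hM x) (ltW MN).
Qed.

(** A compact metric space has a countable base, so an open subset of the product is a countable
    union of basic rectangles. This makes the cost measurable for the product sigma-algebra of
    plans. *)
Lemma open_prod_measurable (U : set (X * X)) : open U ->
  measurable (U : set (borelType X * borelType X)).
Proof.
have [B cB [Bo Bn]] := compact_second_countable cptX.
move=> oU.
pose rectangles :=
  [set p : set X * set X | (B `*` B) p /\ p.1 `*` p.2 `<=` U].
have -> : U = \bigcup_(p in rectangles) (p.1 `*` p.2).
  apply/seteqP; split => [[x y] Uxy|z [p [_ pU] pz]]; last exact: pU.
  have [[V W]/= [xV yW] VWU] : nbhs (x, y) U by move: oU; rewrite openE; exact.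
  have [b1 [Bb1 b1x] b1V] := Bn x V xV.
  have [b2 [Bb2 b2y] b2W] := Bn y W yW.
  exists (b1, b2) => //=; split => // -[u v] [/= b1u b2v].
  by apply: VWU; split; [exact: b1V|exact: b2W].
have [|G [-> GF]] :=
    @countable_bigcup_seq _ _ rectangles (fun p => p.1 `*` p.2).
  apply: (sub_countable (subset_card_le _) (countableX cB cB)).
  by move=> p [].
apply: bigcupT_measurable => n; have [->//|[[b1 b2] [[/= Bb1 Bb2] _] ->]] := GF n.
apply: measurableX.
- exact: (measurable_open_borel (Bo _ _)).
- exact: (measurable_open_borel (Bo _ _)).
Qed.

Lemma measurable_mdist :
  measurable_fun [set: borelType X * borelType X]
    (fun z : borelType X * borelType X => mdist (z.1 : X) z.2 : R).
Proof.
apply: (measurability _ (RGenOpens.measurableE R)).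
move=> _ [_ [a [b ->] <-]]; rewrite setTI.
apply: open_prod_measurable.
have /continuousP : continuous (fun z : X * X => mdist z.1 z.2 : R).
  move=> [x y]; apply/cvgrPdist_lt => e e0 /=.
  exists (ball x (e / 2), ball y (e / 2)) => /=.
    by split; apply: nbhsx_ballx; rewrite divr_gt0.
  move=> [u v]/=; rewrite !ballEmdist/= => -[xu yv].
  have := mdist_lipschitz y x u; have := mdist_lipschitz u y v.
  rewrite (metric_sym y x) (metric_sym y u) !ler_norml => /andP[? ?] /andP[? ?].
  rewrite ltr_norml; lra.
by apply; exact: interval_open.
Qed.

End CompactMetric.

(** * The potential of a measure, its minimizers, and supports *)

Section Potential.
Context {R : realType} {X : pmetricType R}.
Hypothesis cptX : compact [set: X].
Local Open Scope ring_scope.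
Implicit Types (x y z : X) (f g : X -> R) (mu nu : probability (borelType X) R).

Lemma integral_continuous mu f : continuous f ->
  (\int[mu]_x (f x)%:E = (\int[mu]_x f x)%:E)%E.
Proof.
by move=> cf; rewrite fineK//; apply: integrable_fin_num => //; exact: continuous_integrable.
Qed.

Lemma Rintegral_cst1 mu (c : R) : \int[mu]_x c = c.
Proof.
by rewrite Rintegral_cst//= [X in fine X](@probability_setT _ _ _ mu) mulr1.
Qed.

Lemma Rintegral_continuous_le mu f g : continuous f -> continuous g ->
  (forall x, f x <= g x) -> \int[mu]_x f x <= \int[mu]_x g x.
Proof.
move=> cf cg fg; apply: le_Rintegral => //; exact: continuous_integrable.
Qed.

Lemma Rintegral_continuous_lec mu f (c : R) : continuous f ->
  (forall x, f x <= c) -> \int[mu]_x f x <= c.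
Proof.
move=> cf fc; rewrite -[leRHS](Rintegral_cst1 mu).
by apply: Rintegral_continuous_le => // x; exact: cvg_cst.
Qed.

Lemma Rintegral_continuous_gec mu f (c : R) : continuous f ->
  (forall x, c <= f x) -> c <= \int[mu]_x f x.
Proof.
move=> cf fc; rewrite -[leLHS](Rintegral_cst1 mu).
by apply: Rintegral_continuous_le => // x; exact: cvg_cst.
Qed.

Lemma continuous_sqr_comp f : continuous f -> continuous (fun x => f x ^+ 2).
Proof. by move=> cf x; rewrite /=; apply: cvgM; exact: cf. Qed.

Lemma mdistl_continuous y : continuous (fun x : X => mdist x y : R).
Proof.
rewrite (_ : (fun x => _) = mdist y); first exact: mdist_continuous.
by apply/funext => x; rewrite metric_sym.
Qed.

Definition potential mu y : R := \int[mu]_x (mdist x y ^+ 2).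

Lemma var_atE mu y : var_at mu y = (potential mu y)%:E.
Proof.
rewrite /var_at integral_continuous//.
exact/continuous_sqr_comp/mdistl_continuous.
Qed.

(** If distances are at most [D], factoring the difference of squares shows that the squared
    distance is [2 * D]-Lipschitz in one variable; averaging over a probability keeps this
    constant. *)
Lemma potential_continuous mu : continuous (potential mu).
Proof.
have [D D0 dD] := mdist_bounded cptX.
have cd y : continuous (fun x : X => mdist x y ^+ 2 : R).
  exact/continuous_sqr_comp/mdistl_continuous.
have sq x y z : mdist x y ^+ 2 - mdist x z ^+ 2 <= 2 * D * mdist y z :> R.
  rewrite subr_sqr.
  have := dD x y; have := dD x z; have := mdist_ge0 y z.
  have := mdist_lipschitz x y z; have := mdist_ge0 x y; have := mdist_ge0 x z.
  rewrite ler_norml => ? ? /andP[_ ?] ? ? ?.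
  by apply: (@le_trans _ _ (mdist y z * (mdist x y + mdist x z))); nra.
have pot y z : potential mu y - potential mu z <= 2 * D * mdist y z.
  rewrite /potential -RintegralB//; [|exact: continuous_integrable..].
  apply: Rintegral_continuous_lec => [|x]; last exact: sq.
  by move=> x; apply: cvgB; exact: cd.
apply: (@lipschitz_continuous _ _ _ (2 * D)) => y z.
rewrite ler_norml pot andbT lerNl opprB metric_sym; exact: pot.
Qed.

(** Tonelli's theorem for the squared distance, together with its symmetry. *)
Lemma Rintegral_potential mu nu :
  \int[nu]_y potential mu y = \int[mu]_x potential nu x.
Proof.
apply: EFin_inj; rewrite -!integral_continuous; [|exact: potential_continuous..].
under eq_integral do rewrite -var_atE.
under [RHS]eq_integral do rewrite -var_atE.
rewrite /var_at /sqdist.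
rewrite (@fubini_tonelli _ _ _ _ _ nu mu
  (fun z : borelType X * borelType X => (mdist (z.2 : X) (z.1 : X) ^+ 2)%:E))//=.
- by apply: eq_integral => x _; apply: eq_integral => y _; rewrite metric_sym.
- apply/measurable_EFinP/measurable_funX.
  under eq_fun do rewrite metric_sym.
  exact: measurable_mdist.
- by move=> z; rewrite lee_fin sqr_ge0.
Qed.

Definition barycenters mu : set X :=
  [set y | forall x, potential mu y <= potential mu x].

Lemma barycenters_nonempty mu : exists y, barycenters mu y.
Proof. exact: (continuous_argmin cptX (@potential_continuous mu)). Qed.

Lemma varE mu y : barycenters mu y -> var mu = (potential mu y)%:E.
Proof.
move=> ymin; apply/eqP; rewrite eq_le; apply/andP; split.
  by apply: ereal_inf_lbound; exists y => //; rewrite var_atE.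
by apply/ereal_infP => _ [x _ <-]; rewrite var_atE lee_fin.
Qed.

(** The null members of a countable base cover the complement of the support. *)
Lemma supp_null mu : mu.-negligible (~` supp mu : set (borelType X)).
Proof.
have [B cB [Bo Bn]] := compact_second_countable cptX.
have [|G [UG GB]] := @countable_bigcup_seq _ _
    [set U : set X | B U /\ mu U = 0%E] id.
  by apply: (sub_countable (subset_card_le _) cB) => U [].
apply: (@negligibleS _ _ _ mu (\bigcup_n (G n : set (borelType X)))); last first.
  apply: negligible_bigcup => n; have [->|[U [BU U0] ->]] := GB n.
    exact: negligible_set0.
  by apply/negligibleP => //; exact: (measurable_open_borel (Bo _ BU)).
rewrite -UG => x /existsNP[U /not_implyP[oU /not_implyP[Ux U0]]].
have [b [Bb bx] bU] := Bn x U (open_nbhs_nbhs (conj oU Ux)).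
exists b => //; split => //; apply/eqP; rewrite eq_le measure_ge0 andbT.
apply: le_trans (_ : mu U <= 0)%E; last by rewrite leNgt; apply/negP.
by apply: le_measure => //; rewrite inE; apply: measurable_open_borel => //; exact: Bo.
Qed.

(** A zero integral makes the open set where [f] is positive null, and an open null set contains no
    point of the support. *)
Lemma Rintegral_eq0_supp mu f : continuous f -> (forall x, 0 <= f x) ->
  \int[mu]_x f x = 0 -> forall x, supp mu x -> f x = 0.
Proof.
move=> cf f0 If x sx; apply/eqP; rewrite eq_le f0 andbT leNgt; apply/negP => fx.
have oU : open (f @^-1` `]0, +oo[%classic).
  by move/continuousP : cf; apply; exact: interval_open.
have Ux : (f @^-1` `]0, +oo[%classic) x by rewrite /= in_itv/= fx.
have := sx _ oU Ux; apply/negP; rewrite -leNgt.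
have mf := continuous_measurable_borel cf.
have : (\int[mu]_x `|(f x)%:E| = 0)%E.
  under eq_integral do rewrite abse_EFin ger0_norm//.
  by rewrite integral_continuous// If.
move/(ae_eq_integral_abs mu measurableT (iffRL (measurable_EFinP _ _) mf)).
move=> [N [mN N0 fN]]; rewrite -N0.
apply: le_measure; rewrite ?inE//; first exact: measurable_open_borel oU.
move=> y /=; rewrite in_itv/= andbT => fy; apply: fN => /= /(_ I) [] fy0.
by rewrite fy0 ltxx in fy.
Qed.

Lemma Rintegral_supp_eq0 mu f : continuous f -> (forall x, supp mu x -> f x = 0) ->
  \int[mu]_x f x = 0.
Proof.
move=> cf f0; rewrite /Rintegral (ae_eq_integral (cst 0%E))//.
- by rewrite integral0.
- by apply/measurable_EFinP; exact: continuous_measurable_borel.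
apply: (@negligibleS _ _ _ mu _ _ _ (@supp_null mu)) => x /= fx sx.
by apply: fx => _; rewrite f0.
Qed.

End Potential.

Lemma probability_pushforward d d' (S : measurableType d) (T : measurableType d')
    (R : realType) (P : probability S R) (f : S -> T) :
  measurable_fun setT f -> exists Q : probability T R,
    (forall A, Q A = P (f @^-1` A)) /\
    forall g : T -> \bar R, measurable_fun setT g -> (forall y, 0 <= g y) ->
      \int[Q]_y g y = \int[P]_x g (f x).
Proof.
move=> mf; exists (distribution P (mfun_Sub (mem_set mf))); split => // g mg g0.
by rewrite ge0_integral_distribution.
Qed.

(** * Distance to a set and measurable almost-nearest-point maps *)

Section DistanceToSet.
Context {R : realType} {X : pmetricType R}.
Local Open Scope ring_scope.
Implicit Types (x y k : X) (K : set X).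

(** The infimum of the empty set is 0 by convention, so lower bounds are stated for nonempty [K]. *)
Definition setdist K x : R := inf [set mdist x k | k in K].

Lemma setdist_le K x k : K k -> setdist K x <= mdist x k.
Proof.
move=> Kk; apply: ge_inf; last by exists k.
by exists 0 => _ [j _ <-]; exact: mdist_ge0.
Qed.

Lemma le_setdist K x (c : R) : K !=set0 ->
  (forall k, K k -> c <= mdist x k) -> c <= setdist K x.
Proof.
move=> [k Kk] cK; apply: lb_le_inf; first by exists (mdist x k); exists k.
by move=> _ [j Kj <-]; exact: cK.
Qed.

Lemma setdist_ge0 K x : K !=set0 -> 0 <= setdist K x.
Proof. by move=> K0; apply: le_setdist => // k _; exact: mdist_ge0. Qed.

Lemma setdist_eq0 K k : K k -> setdist K k = 0.
Proof.
move=> Kk; apply/eqP; rewrite eq_le setdist_ge0 ?andbT; last by exists k.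
by rewrite -(mdistxx k); exact: setdist_le.
Qed.

Lemma setdist_triangle K x y : K !=set0 -> setdist K x <= mdist x y + setdist K y.
Proof.
move=> K0; rewrite -lerBlDl; apply: le_setdist => // k Kk.
by rewrite lerBlDl (le_trans (setdist_le x Kk))// metric_triangle.
Qed.

Lemma setdist_continuous K : K !=set0 -> continuous (setdist K).
Proof.
move=> K0; apply: (@lipschitz_continuous _ _ _ 1) => x y.
have := setdist_triangle x y K0; have := setdist_triangle y x K0.
rewrite (metric_sym y x) => *; rewrite ler_norml; lra.
Qed.

Hypothesis cptX : compact [set: X].

(** Induction on [s]: the new point replaces the old choice wherever it is at least as close, a
    measurable condition by joint measurability of the distance. *)
Lemma measurable_nearest K (s : seq X) : K !=set0 -> (forall p, p \in s -> K p) ->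
  exists T : borelType X -> borelType X,
    [/\ measurable_fun setT T, forall x, K (T x) &
        forall x p, p \in s -> mdist (x : X) (T x : X) <= mdist x p :> R].
Proof.
move=> [k Kk]; elim: s => [_|p s IHs sK].
  by exists (fun=> k); split.
have [q qs|T [mT KT Ts]] := IHs; first by apply: sK; rewrite inE qs orbT.
have Kp : K p by apply: sK; rewrite inE eqxx.
have mIT := measurable_fun_pair (@measurable_id _ (borelType X) setT) mT.
exists (fun x => if mdist (x : X) p <= mdist (x : X) (T x) :> R then p else T x); split.
- apply: measurable_fun_ifT => //.
  apply: measurable_fun_ler.
    exact: continuous_measurable_borel (@mdistl_continuous _ _ p).
  exact: (measurableT_comp (measurable_mdist cptX) mIT).
- by move=> x; case: ifP.
move=> x q; rewrite inE => /predU1P[->|qs].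
  by case: ifPn => //; rewrite -ltNge => /ltW.
by case: ifPn => [xp|_]; [exact: le_trans xp (Ts x q qs)|exact: Ts].
Qed.

(** The nearest point in a finite [e]-net of the compact set [K] loses at most [e], and choosing
    among finitely many points needs no measurable selection theorem. *)
Lemma measurable_near_projection K (e : R) : closed K -> K !=set0 -> 0 < e ->
  exists T : borelType X -> borelType X,
    [/\ measurable_fun setT T, forall x, K (T x) &
        forall x : X, mdist x (T x : X) <= setdist K x + e].
Proof.
move=> clK K0 e0.
have : cover_compact K.
  by rewrite -compact_cover; exact: subclosed_compact clK cptX _.
(* The cover must consist of open sets, hence the interiors of the balls. *)
move=> /(_ X K (fun k => (ball k e)^°)) [||s sK Ks].
- by move=> k _; exact: open_interior.
- move=> k Kk; exists k => //; exact: nbhsx_ballx.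
have [|T [mT KT Ts]] := @measurable_nearest K (finmap.enum_fset s) K0.
  by move=> p /sK; rewrite inE.
exists T; split => // x; rewrite -lerBlDr; apply: le_setdist => // k Kk.
have [p ps /interior_subset] := Ks _ Kk.
rewrite ballEmdist/= lerBlDr => pk.
rewrite (le_trans (Ts x p _))// (le_trans (metric_triangle x k p))//.
by rewrite lerD2l metric_sym ltW.
Qed.

End DistanceToSet.

(** * Upper and lower bounds on the transport cost *)

Section Transport.
Context {R : realType} {X : pmetricType R}.
Hypothesis cptX : compact [set: X].
Implicit Types (x y z : X) (f g h : X -> R) (m mu nu : probability (borelType X) R).

Lemma W2sq_ge0 m nu : 0 <= W2sq m nu.
Proof.
apply/ereal_infP => _ [gamma _ <-]; apply: integral_ge0 => z _.
by rewrite lee_fin sqr_ge0.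
Qed.

Lemma measurable_sqdist : measurable_fun [set: borelType X * borelType X]
  (fun z : borelType X * borelType X => sqdist (z.1 : X) (z.2 : X)).
Proof. by apply/measurable_EFinP/measurable_funX; exact: measurable_mdist. Qed.

Lemma measurable_EFin_continuous f : continuous f ->
  measurable_fun [set: borelType X] (fun x : borelType X => (f x)%:E).
Proof. by move=> cf; apply/measurable_EFinP; exact: continuous_measurable_borel. Qed.

(** Take for [nu] the image of [m] under [T], and for the plan the image under [(id, T)]. That [nu]
    lives on [K] is expressed by test functions constant on [K], ready for use with the potential on
    its set of minimizers. *)
Lemma transport_competitor m (K : set X) (T : borelType X -> borelType X) h :
  measurable_fun setT T -> (forall x, K (T x)) -> continuous h ->
  (forall x : X, (mdist x (T x : X) ^+ 2 <= h x)%R) ->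
  exists nu,
    (forall f (c : R), continuous f -> (forall x, 0 <= f x)%R ->
       (forall k, K k -> f k = c) -> (\int[nu]_x f x)%R = c) /\
    W2sq m nu <= (\int[m]_x h x)%R%:E.
Proof.
move=> mT KT ch hT.
have [nu [nuE nuI]] := probability_pushforward m mT.
have mIT := measurable_fun_pair (@measurable_id _ (borelType X) setT) mT.
have [gamma [gE gI]] := probability_pushforward m mIT.
exists nu; split.
  move=> f c cf f0 fK; rewrite /Rintegral nuI; last first.
  - by move=> y; rewrite lee_fin.
  - exact: measurable_EFin_continuous.
  under eq_integral do rewrite fK//.
  exact: Rintegral_cst1.
apply: (@le_trans _ _ (cost gamma)).
  apply: ereal_inf_lbound; exists gamma => //; split => A mA.
  - by rewrite /pushforward gE.
  - by rewrite /pushforward gE nuE.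
rewrite /cost gI; last 2 first.
- exact: measurable_sqdist.
- by move=> z; rewrite lee_fin sqr_ge0.
rewrite -integral_continuous//; apply: ge0_le_integral => //.
- by move=> x _; rewrite lee_fin sqr_ge0.
- exact: measurableT_comp measurable_sqdist mIT.
- exact: measurable_EFin_continuous.
- by move=> x _; rewrite lee_fin; exact: hT.
Qed.

(** The easy half of Kantorovich duality for the pair [f], [- g]: integrate the pointwise inequality
    against any coupling. Keeping [g] on the cost side leaves all integrands nonnegative. *)
Lemma weak_duality m nu f g : continuous f -> continuous g ->
  (forall x, 0 <= f x)%R -> (forall y, 0 <= g y)%R ->
  (forall x y, f x <= mdist x y ^+ 2 + g y)%R ->
  (\int[m]_x f x)%R%:E <= W2sq m nu + (\int[nu]_y g y)%R%:E.
Proof.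
move=> cf cg f0 g0 fg; rewrite -leeBlDr//.
apply/ereal_infP => _ [gamma [gm gn] <-]; rewrite leeBlDr//.
have mf := measurable_EFin_continuous cf.
have mg := measurable_EFin_continuous cg.
rewrite -!integral_continuous//.
rewrite -(@eq_measure_integral _ _ _ _ m (pushforward gamma fst)); last first.
  by move=> A mA _; exact: gm.
rewrite -(@eq_measure_integral _ _ _ _ nu (pushforward gamma snd)); last first.
  by move=> A mA _; exact: gn.
rewrite !ge0_integral_pushforward//; last 2 first.
- by move=> x _; rewrite lee_fin.
- by move=> x _; rewrite lee_fin.
rewrite !preimage_setT -ge0_integralD//.
- apply: ge0_le_integral => //.
  + by move=> z _; rewrite lee_fin.
  + exact: measurableT_comp mf measurable_fst.
  + apply: emeasurable_funD; first exact: measurable_sqdist.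
    exact: measurableT_comp mg measurable_snd.
  + by move=> z _; rewrite -EFinD lee_fin; exact: fg.
- by move=> z _; rewrite lee_fin sqr_ge0.
- exact: measurable_sqdist.
- by move=> z _; rewrite lee_fin.
- exact: measurableT_comp mg measurable_snd.
Qed.

End Transport.

(** * Regularized minimizers and the support of their limit *)

Section RegularizedBarycenter.
Context {R : realType} {X : pmetricType R}.
Hypothesis cptX : compact [set: X].
Implicit Types (x y z : X) (f g h : X -> R) (m mu nu : probability (borelType X) R).

Lemma potential_ge0 mu y : (0 <= potential mu y)%R.
Proof. by apply: Rintegral_ge0 => x _; exact: sqr_ge0. Qed.

Lemma reg_functionalE m mu (e : R) nu :
  reg_functional m mu e nu =
  (\int[nu]_y potential mu y)%R%:E + e%:E * W2sq m nu.
Proof.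
rewrite /reg_functional -(integral_continuous cptX) ?potential_continuous//.
  congr (_ + _); apply: eq_integral => y _; rewrite -var_atE//.
  by apply: eq_integral => x _; rewrite /sqdist metric_sym.
exact: potential_continuous.
Qed.

Lemma potential_le_average mu nu y : barycenters mu y ->
  (potential mu y <= \int[nu]_z potential mu z)%R.
Proof.
by move=> yb; apply: Rintegral_continuous_gec => //; exact: potential_continuous.
Qed.

(** The competitor is the image of [m] under [T]: it is carried by the minimizers of the potential,
    so only its transport term exceeds [potential mu y]. *)
Lemma reg_minimizer_le m mu (e : R) nu y (T : borelType X -> borelType X) h :
  reg_minimizer m mu e nu -> (0 < e)%R -> barycenters mu y ->
  measurable_fun setT T -> (forall x, barycenters mu (T x)) -> continuous h ->
  (forall x : X, (mdist x (T x : X) ^+ 2 <= h x)%R) ->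
  (\int[nu]_z potential mu z)%R%:E + e%:E * W2sq m nu <=
  (potential mu y + e * \int[m]_x h x)%R%:E.
Proof.
move=> minnu e0 yb mT Tb ch hT.
have [nu' [nu'E nu'W]] := transport_competitor cptX m mT Tb ch hT.
rewrite -reg_functionalE; apply: le_trans (minnu nu') _.
rewrite reg_functionalE (nu'E _ (potential mu y)).
- by rewrite EFinD EFinM leeD2l// lee_pmul2l.
- exact: potential_continuous.
- exact: potential_ge0.
- by move=> k kb; apply/eqP; rewrite eq_le; apply/andP; split; [exact: kb|exact: yb].
Qed.

Lemma Rintegral_potential_regularized m mu nu y :
  is_regularized_barycenter m mu nu -> barycenters mu y ->
  (\int[nu]_z potential mu z)%R = potential mu y.
Proof.
move=> [nu_ [nu_min nu_cvg]] yb.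
apply/eqP; rewrite eq_le potential_le_average// andbT.
have [D D0 dD] := mdist_bounded cptX.
have bound (e : R) : (0 < e)%R ->
    (\int[nu_ e]_z potential mu z <= potential mu y + e * D ^+ 2)%R.
  move=> e0.
  (* The constant map to [y] yields the Dirac competitor, with transport cost at most [D ^+ 2]. *)
  have := @reg_minimizer_le m mu e (nu_ e) y (fun=> y) (fun=> D ^+ 2)%R
    (nu_min e e0) e0 yb (@measurable_cst _ _ (borelType X) _ _ _) (fun=> yb).
  rewrite Rintegral_cst1 => le_.
  rewrite -lee_fin; apply: le_trans (le_ _ _).
  - by rewrite leeDl// mule_ge0 ?W2sq_ge0// lee_fin ltW.
  - by move=> x; exact: cvg_cst.
  - by move=> x; rewrite ler_pXn2r ?nnegrE ?mdist_ge0// ltW.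
apply/ler_addgt0Pr => d d0.
have cp : continuous (potential mu) by exact: potential_continuous.
apply: (cvgr_to_le (nu_cvg _ cp)).
near=> e.
apply: le_trans (bound e _) _; first by near: e; exact: nbhs_right_gt.
rewrite lerD2l -ler_pdivlMr ?exprn_gt0//; near: e; apply: nbhs_right_le.
by rewrite divr_gt0// exprn_gt0.
Unshelve. all: by end_near. Qed.

(** The excess of the potential over its minimum is continuous, nonnegative and of zero integral
    against [nu]. *)
Lemma supp_regularized_barycenters m mu nu :
  is_regularized_barycenter m mu nu -> supp nu `<=` barycenters mu.
Proof.
move=> mub x sx.
have [y yb] := barycenters_nonempty cptX mu.
have cp := @potential_continuous _ _ cptX mu.
have cpy : continuous (fun z => potential mu z - potential mu y)%R.
  by move=> z; apply: cvgB; [exact: cp|exact: cvg_cst].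
have /eqP : (potential mu x - potential mu y = 0)%R.
  apply: (Rintegral_eq0_supp cptX cpy) sx => [z|]; first by rewrite subr_ge0; exact: yb.
  rewrite RintegralB//; [|exact: continuous_integrable|].
    by rewrite Rintegral_cst1 (Rintegral_potential_regularized mub yb) subrr.
  by apply: continuous_integrable => // z; exact: cvg_cst.
by rewrite subr_eq0 => /eqP xy z; rewrite xy; exact: yb.
Qed.

Lemma closed_barycenters mu : closed (barycenters mu).
Proof.
have [y yb] := barycenters_nonempty cptX mu.
rewrite (_ : barycenters mu = potential mu @^-1` [set r | r <= potential mu y]%R).
  apply: closed_comp; last exact: closed_le.
  by move=> x _; exact: potential_continuous.
apply/seteqP; split => x /= => [xb|xy z]; first exact: xb.
exact: le_trans xy (yb z).
Qed.

(** Almost-projections onto [K] already achieve the least average potential, so a minimizer can only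
    beat them in transport cost. The bound is independent of [e]. *)
Lemma W2sq_reg_minimizer_le m mu (e : R) nu : reg_minimizer m mu e nu -> (0 < e)%R ->
  W2sq m nu <= (\int[m]_x setdist (barycenters mu) x ^+ 2)%R%:E.
Proof.
move=> minnu e0; set K := barycenters mu.
have [y yb] := barycenters_nonempty cptX mu.
have K0 : K !=set0 by exists y.
have [D D0 dD] := mdist_bounded cptX.
have cs : continuous (fun x => setdist K x ^+ 2)%R.
  by apply: continuous_sqr_comp; exact: setdist_continuous.
apply/lee_addgt0Pr => d d0.
(* Numbers in [[0, D]] that differ by at most [d / (2 * D)] have squares differing by at most
   [d]. *)
have d'0 : (0 < d / (2 * D))%R by rewrite divr_gt0// mulr_gt0.
have [T [mT TK Td]] := measurable_near_projection cptX (@closed_barycenters mu) K0 d'0.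
have cd : continuous (cst d : X -> R) by move=> x; exact: cvg_cst.
have ch : continuous (fun x => setdist K x ^+ 2 + d)%R.
  by move=> x; apply: cvgD; [exact: cs|exact: cd].
have hT (x : X) : (mdist x (T x : X) ^+ 2 <= setdist K x ^+ 2 + d)%R.
  have sD : (setdist K x <= D)%R by exact: le_trans (setdist_le x yb) (dD x y).
  have s0 := setdist_ge0 x K0.
  rewrite -lerBlDl subr_sqr.
  have -> : d = (d / (2 * D) * (2 * D))%R by rewrite divfK// mulf_neq0 ?gt_eqF.
  have := Td x; rewrite -lerBlDl => td.
  have tD := dD x (T x); have t0 : (0 <= mdist x (T x : X) :> R)%R := mdist_ge0 _ _.
  apply: (@le_trans _ _ (d / (2 * D) * (mdist x (T x : X) + setdist K x))%R).
    by rewrite ler_wpM2r// addr_ge0.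
  by rewrite ler_wpM2l ?(ltW d'0)//; lra.
have := reg_minimizer_le minnu e0 yb mT TK ch hT.
rewrite RintegralD//; [|exact: continuous_integrable..].
rewrite Rintegral_cst1 => le_.
(* Lower the average potential on the left to its minimum, then cancel it and divide by [e]. *)
have := le_trans (leeD2r _ _) le_; rewrite EFinD => /(_ (potential mu y)%:E).
rewrite lee_fin => /(_ (potential_le_average nu yb)).
by rewrite leeD2lE// EFinM lee_pmul2l.
Qed.

(** Suppose a ball around a minimizer [z] is null for [nu]. Duality with bumps at [z] bounds the
    integral of [g] against [m] by that of [k] against [nu_ e]. The latter tends to 0, although
    [g z] is positive and [z] lies in the support of [m]. *)
Lemma barycenters_supp_regularized m mu nu :
  is_regularized_barycenter m mu nu -> supp m = [set: X] ->
  barycenters mu `<=` supp nu.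
Proof.
move=> mub sm z zb; apply: contrapT => zs.
have subK := supp_regularized_barycenters mub.
have [nu_ [nu_min nu_cvg]] := mub.
move: zs => /existsNP[U /not_implyP[oU /not_implyP[Uz U0]]].
have [r /= r0 rU] : exists2 r : R, (0 < r)%R & ball z r `<=` U.
  by have /nbhs_ballP[r /= r0 rU] := open_nbhs_nbhs (conj oU Uz); exists r.
have K0 : barycenters mu !=set0 by exists z.
have [D D0 dD] := mdist_bounded cptX.
set s := setdist (barycenters mu).
have s0 x : (0 <= s x)%R by exact: setdist_ge0.
have sD x : (s x <= D)%R by exact: le_trans (setdist_le x zb) (dD x z).
have cs : continuous s by exact: setdist_continuous.
have bump_continuous (a b : R) :
    continuous (fun x => a * Num.max 0 (b - mdist z x) : R)%R.
  move=> x; apply: cvgM; first exact: cvg_cst.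
  apply: (@continuous_max R X (cst 0%R) (fun x => b - mdist z x)%R x).
    exact: cvg_cst.
  by apply: cvgB; [exact: cvg_cst|exact: mdist_continuous].
(* The scales are chosen so that [g] is at most [r ^+ 2 / 8], while [f] is at least [r ^+ 2 / 4]
   within [3 / 4 * r] of [z]: targets there pay for the gain in [g]. *)
set g := fun x => (r / 2 * Num.max 0 (r / 4 - mdist z x) : R)%R.
set f := fun y => (r * Num.max 0 (r - mdist z y) : R)%R.
have cg : continuous g by exact: bump_continuous.
have cf : continuous f by exact: bump_continuous.
have g0 x : (0 <= g x)%R.
  by rewrite mulr_ge0 ?le_max ?lexx// divr_ge0// ltW.
have f0 y : (0 <= f y)%R.
  by rewrite mulr_ge0 ?le_max ?lexx// ltW.
set k := fun y => (2 * D * s y + f y)%R.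
have ck : continuous k.
  move=> y; apply: cvgD; last exact: cf.
  by apply: cvgM; [exact: cvg_cst|exact: cs].
have k0 y : (0 <= k y)%R by rewrite addr_ge0// mulr_ge0// mulr_ge0// ltW.
(* Off the bumps this is [d(x,K) <= d(x,y) + d(y,K)]; if [x] is within [r/4] of
   [z] but [y] is not within [3r/4], then [d(x,y) >= r/2] while [d(x,K) <= r/4]. *)
have key x y : (s x ^+ 2 + g x <= mdist x y ^+ 2 + k y)%R.
  have sxy : (s x <= mdist x y + s y)%R by exact: setdist_triangle.
  have sxz : (s x <= mdist x z)%R by exact: setdist_le.
  have tri := metric_triangle z x y.
  have := dD x y; have := mdist_ge0 x y; have := mdist_ge0 z x; have := mdist_ge0 z y.
  have := s0 x; have := s0 y; have := sD x.
  rewrite /k /f /g; move: sxz sxy tri; rewrite (metric_sym x z).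
  move: (mdist x y : R) (mdist z x : R) (mdist z y : R) (s x) (s y) => d a b sx sy.
  move=> *.
  (* If [sx] exceeds [d], then [(sx - d) * (sx + d)] is at most [sy * (2 * D)]. *)
  have base : (sx ^+ 2 <= d ^+ 2 + 2 * D * sy)%R by nra.
  have [ar|ar] := leP (r / 4 - a)%R 0%R.
    have f0' : (0 <= r * Num.max 0 (r - b))%R by rewrite mulr_ge0 ?le_max ?lexx// ltW.
    by rewrite mulr0; lra.
  have [br|br] := leP b (3 / 4 * r)%R.
    have -> : Num.max 0%R (r - b)%R = (r - b)%R by apply/max_idPr; lra.
    by nra.
  have f0' : (0 <= r * Num.max 0 (r - b))%R by rewrite mulr_ge0 ?le_max ?lexx// ltW.
  (* The left side is at most [r ^+ 2 / 16 + r ^+ 2 / 8], below [r ^+ 2 / 4]. *)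
  suff : (sx ^+ 2 + r / 2 * (r / 4 - a) <= d ^+ 2)%R by nra.
  have : (a ^+ 2 <= (r / 4) ^+ 2)%R by nra.
  have : ((r / 2) ^+ 2 <= d ^+ 2)%R by nra.
  by nra.
(* The projection bound on [W2sq] cancels the [s x ^+ 2] term of the dual inequality. *)
have mass (e : R) : (0 < e)%R -> (\int[m]_x g x <= \int[nu_ e]_y k y)%R.
  move=> e0.
  have csg : continuous (fun x => s x ^+ 2 + g x)%R.
    by move=> x; apply: cvgD; [exact: continuous_sqr_comp|exact: cg].
  have sg0 x : (0 <= s x ^+ 2 + g x)%R by rewrite addr_ge0// sqr_ge0.
  have := weak_duality cptX m (nu_ e) csg ck sg0 k0 key.
  rewrite RintegralD//; [|apply: continuous_integrable => //; exact: continuous_sqr_comp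
    |exact: continuous_integrable].
  move=> /le_trans -/(_ _ (leeD2r _ (W2sq_reg_minimizer_le (nu_min e e0) e0))).
  by rewrite -EFinD lee_fin lerD2l.
(* On the support of [nu], [s] vanishes because the support lies in the minimizers, and [f] vanishes
   because the support avoids [U]. *)
have nuk : (\int[nu]_y k y = 0)%R.
  apply: Rintegral_supp_eq0 => // y sy.
  rewrite /k /s setdist_eq0; last exact: subK.
  rewrite mulr0 add0r /f; apply/eqP; rewrite mulf_eq0 gt_eqF//=; apply/eqP/max_idPl.
  rewrite subr_le0 leNgt; apply/negP => zy; apply: U0; apply: sy => //.
  by apply: rU; rewrite ballEmdist.
have mg : (\int[m]_x g x = 0)%R.
  apply/eqP; rewrite eq_le; apply/andP; split; last exact: Rintegral_ge0.
  rewrite -nuk; apply: (cvgr_to_ge (nu_cvg _ ck)).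
  by near=> e; apply: mass; near: e; exact: nbhs_right_gt.
have : supp m z by rewrite sm.
move/(Rintegral_eq0_supp cptX cg g0 mg); rewrite /g mdistxx subr0.
rewrite (max_idPr _); last by rewrite divr_ge0// ltW.
by apply/eqP; rewrite gt_eqF// mulr_gt0// divr_gt0.
Unshelve. all: by end_near. Qed.

End RegularizedBarycenter.

(** * Comparison of the two variances and the case of equality *)

Theorem corollary3p3 (R : realType) (X : pmetricType R)
    (m : probability (borelType X) R)
    (cptX : compact [set: X]) (regm : regular m)
    (mu Bmu BBmu : probability (borelType X) R)
    (hB : is_regularized_barycenter m mu Bmu)
    (hBB : is_regularized_barycenter m Bmu BBmu) :
  var Bmu <= var mu /\
  (supp mu `<=` supp BBmu -> var Bmu = var mu) /\
  (supp m = [set: X] -> var Bmu = var mu -> supp mu `<=` supp BBmu).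
Proof.
have [y yb] := barycenters_nonempty cptX mu.
have [z zb] := barycenters_nonempty cptX Bmu.
rewrite (varE cptX yb) (varE cptX zb).
have mean : (\int[mu]_x potential Bmu x = potential mu y)%R.
  by rewrite Rintegral_potential// (Rintegral_potential_regularized cptX hB yb).
have cp := @potential_continuous _ _ cptX Bmu.
(* This function is nonnegative and its integral against [mu] is the drop in variance, so equality
   means that it vanishes on [supp mu]. *)
pose excess x := (potential Bmu x - potential Bmu z)%R.
have cex : continuous excess.
  by move=> x; apply: cvgB; [exact: cp|exact: cvg_cst].
have Iexcess : (\int[mu]_x excess x = potential mu y - potential Bmu z)%R.
  rewrite RintegralB//; [|exact: continuous_integrable|].
    by rewrite mean Rintegral_cst1.
  by apply: continuous_integrable => // x; exact: cvg_cst.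
split; first by rewrite lee_fin -mean; exact: potential_le_average.
split=> [sub|sm [eq_var] x sx].
  congr EFin; apply/esym/eqP; rewrite -subr_eq0 -Iexcess; apply/eqP.
  apply: Rintegral_supp_eq0 => // x /sub /(supp_regularized_barycenters cptX hBB) xb.
  by apply/eqP; rewrite /excess subr_eq0 eq_le xb zb.
(* Full support of [m] reduces the claim to [x] minimizing the potential of [Bmu]. *)
apply: (barycenters_supp_regularized cptX hBB sm) => w.
have : excess x = 0%R.
  apply: (Rintegral_eq0_supp cptX cex) sx => [v|]; first by rewrite subr_ge0; exact: zb.
  by rewrite Iexcess eq_var subrr.
by move/eqP; rewrite subr_eq0 => /eqP ->; exact: zb.
Qed.
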